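(* For a positive integer $n$, there exists a loop $Q$ of order $n$ satisfying $P(Q)=Q$ if and only if $n=1$ or $n\ge 5$.
   Context: A quasigroup is a set $Q$ with a binary operation $\cdot$ such that for all $a,b\in Q$ the equations $ax=b$ and $ya=b$ have unique solutions $x,y\in Q$. A loop is a quasigroup with a two-sided neutral element. For a finite loop $Q$, $P(Q)$ denotes the set of all elements of $Q$ that can be obtained as a product of all the elements of $Q$, each used exactly once, in some order and with some bracketing. *)

(* Defs.v *)
From mathcomp Require Import all_boot.

Set Implicit Arguments.
Unset Strict Implicit.
Unset Printing Implicit Defensive.

Definition is_quasigroup (Q : Type) (mul : Q -> Q -> Q) : Prop :=
  forall a b : Q,
    (exists! x : Q, mul a x = b) /\ (exists! y : Q, mul y a = b).

Definition is_loop (Q : Type) (mul : Q -> Q -> Q) : Prop :=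
  is_quasigroup mul /\ exists e : Q, left_id e mul /\ right_id e mul.

(* A fully bracketed nonempty word: the sequence of factors together with the
   bracketing.  There is no empty word, so the neutral element is not a product
   of nothing. *)
Inductive bracketed_word (Q : Type) : Type :=
| Factor of Q
| Product of bracketed_word Q & bracketed_word Q.

Fixpoint factors (Q : Type) (w : bracketed_word Q) : seq Q :=
  match w with
  | Factor x => [:: x]
  | Product u v => factors u ++ factors v
  end.

Fixpoint value (Q : Type) (mul : Q -> Q -> Q) (w : bracketed_word Q) : Q :=
  match w with
  | Factor x => x
  | Product u v => mul (value mul u) (value mul v)
  end.

(* The set P(Q), as a predicate on Q. *)
Definition full_product (Q : finType) (mul : Q -> Q -> Q) (q : Q) : Prop :=
  exists w : bracketed_word Q,
    (forall x : Q, count_mem x (factors w) = 1) /\ value mul w = q.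

(* Main.v *)
(* A loop of order at most 4 is an abelian group, so all the products of its
   elements coincide.  For [n >= 6], prolong the cyclic group [G] of order
   [n - 1] along a permutation [th] of its nonzero elements for which the sums
   [x + th x] are distinct: the new element [None] gives
   [None * th z = z + th z], so multiplying by the remaining elements of [G] in
   an order that avoids the modified cells yields [s + z], where [s] is both
   the sum of [G] and the only element not of the form [x + th x], [x != 0].
   The two products [None] and [s] not obtained in this way are reached by
   creating [None] again from a pair [u, th u]. *)
Require Import Defs.
From HB Require Import structures.
From mathcomp Require Import all_boot all_algebra zify.

Set Implicit Arguments.
Unset Strict Implicit.
Unset Printing Implicit Defensive.

Import GRing.Theory.

(** * Finite quasigroups and products over a list of factors *)

Lemma inj_is_quasigroup (Q : finType) (mul : Q -> Q -> Q) :
  (forall a, injective (mul a)) -> (forall a, injective (mul^~ a)) ->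
  is_quasigroup mul.
Proof.
move=> injl injr a b; split.
- exists (invF (injl a) b); split; first exact: f_invF.
  by move=> x <-; rewrite invF_f.
- exists (invF (injr a) b); split; first exact: (f_invF (injr a)).
  by move=> x <-; rewrite (invF_f (injr a)).
Qed.

Lemma quasigroup_injl (Q : Type) (mul : Q -> Q -> Q) (a : Q) :
  is_quasigroup mul -> injective (mul a).
Proof.
move=> qg x y Exy; have [[z [_ uz]] _] := qg a (mul a y).
by rewrite -(uz _ Exy) -(uz y).
Qed.

Lemma quasigroup_injr (Q : Type) (mul : Q -> Q -> Q) (a : Q) :
  is_quasigroup mul -> injective (mul^~ a).
Proof.
move=> qg x y /= Exy; have [_ [z [_ uz]]] := qg a (mul y a).
by rewrite -(uz _ Exy) -(uz y).
Qed.

(** A relative form of [full_product]: fixing the factors only up to order lets products be built up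
    one factor at a time. *)
Definition product_of (Q : eqType) (mul : Q -> Q -> Q) (s : seq Q) (q : Q) :=
  exists2 w, perm_eq (factors w) s & value mul w = q.

Lemma product_of_factor (Q : eqType) (mul : Q -> Q -> Q) (x : Q) :
  product_of mul [:: x] x.
Proof. by exists (Factor x). Qed.

Lemma product_of_mul (Q : eqType) (mul : Q -> Q -> Q) s t x y :
  product_of mul s x -> product_of mul t y -> product_of mul (s ++ t) (mul x y).
Proof.
move=> [u us <-] [v vt <-]; exists (Product u v) => //=.
exact: perm_cat.
Qed.

Lemma product_of_perm (Q : eqType) (mul : Q -> Q -> Q) s t x :
  perm_eq s t -> product_of mul s x -> product_of mul t x.
Proof. by move=> st [w ws <-]; exists w => //; apply: perm_trans st. Qed.

Lemma product_of_rcons (Q : eqType) (mul : Q -> Q -> Q) s x y :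
  product_of mul s x -> product_of mul (rcons s y) (mul x y).
Proof.
by rewrite -cats1 => sx; apply: product_of_mul sx (product_of_factor _ _).
Qed.

Lemma product_of_enum (Q : finType) (mul : Q -> Q -> Q) s q :
  perm_eq s (enum Q) -> product_of mul s q -> full_product mul q.
Proof.
move=> sQ [w ws wq]; exists w; split=> // x.
rewrite (permP (perm_trans ws sQ)) count_uniq_mem ?enum_uniq //.
by rewrite mem_enum.
Qed.

(** * Loops of order at most 4 *)

Lemma full_product_unique (Q : finType) (mul : Q -> Q -> Q) (e p q : Q) :
  associative mul -> commutative mul -> left_id e mul ->
  full_product mul p -> full_product mul q -> p = q.
Proof.
move=> mulA mulC mul1.
pose M : Monoid.com_law e :=
  HB.pack mul (Monoid.isComLaw.Build Q e mul mulA mulC mul1).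
have valE w : value mul w = \big[M/e]_(x <- factors w) x.
  elim: w => [x|u IHu v IHv]; first by rewrite big_seq1.
  by rewrite [factors _]/= big_cat -IHu -IHv.
move=> [u [fu <-]] [v [fv <-]]; rewrite !valE; apply: perm_big.
by apply/allP => x _ /=; rewrite fu fv.
Qed.

(** Cancellation makes the Cayley table a Latin square bordered by [e]. Only four such tables exist,
    one for the Klein group and three labellings of Z_4, and each is checked directly. *)
Lemma loop_card4_abelian (Q : Type) (mul : Q -> Q -> Q) (e a b c : Q) :
  is_quasigroup mul -> left_id e mul -> right_id e mul ->
  a <> e -> b <> e -> c <> e -> a <> b -> a <> c -> b <> c ->
  (forall x, [\/ x = e, x = a, x = b | x = c]) ->
  associative mul /\ commutative mul.
Proof.
move=> qg mul1 mulr1 ae be ce ab ac bc E.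
have injl x := @quasigroup_injl _ mul x qg.
have injr x := @quasigroup_injr _ mul x qg.
have ne x y : x <> e -> y <> e -> mul x y <> x /\ mul x y <> y.
  move=> xe ye; split=> H; [apply: ye|apply: xe].
  - by apply: (injl x); rewrite H mulr1.
  - by apply: (injr y); rewrite H mul1.
have [Naa _] := ne _ _ ae ae; have [Nbb _] := ne _ _ be be.
have [Ncc _] := ne _ _ ce ce.
have [Nab1 Nab2] := ne _ _ ae be; have [Nba1 Nba2] := ne _ _ be ae.
have [Nac1 Nac2] := ne _ _ ae ce; have [Nca1 Nca2] := ne _ _ ce ae.
have [Nbc1 Nbc2] := ne _ _ be ce; have [Ncb1 Ncb2] := ne _ _ ce be.
have la x y : x <> y -> mul a x <> mul a y by move=> xy /injl.
have lb x y : x <> y -> mul b x <> mul b y by move=> xy /injl.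
have lc x y : x <> y -> mul c x <> mul c y by move=> xy /injl.
have ra x y : x <> y -> mul x a <> mul y a by move=> xy /(@injr a).
have rb x y : x <> y -> mul x b <> mul y b by move=> xy /(@injr b).
have rc x y : x <> y -> mul x c <> mul y c by move=> xy /(@injr c).
have := (la _ _ ab, la _ _ ac, la _ _ bc, ra _ _ ab, ra _ _ ac, ra _ _ bc).
have := (lb _ _ ab, lb _ _ ac, lb _ _ bc, rb _ _ ab, rb _ _ ac, rb _ _ bc).
have := (lc _ _ ab, lc _ _ ac, lc _ _ bc, rc _ _ ab, rc _ _ ac, rc _ _ bc).
move=> [[[[[? ?] ?] ?] ?] ?] [[[[[? ?] ?] ?] ?] ?] [[[[[? ?] ?] ?] ?] ?].
clear la lb lc ra rb rc ne injl injr qg.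
have [H|H|H|H] := E (mul a b); try congruence;
have [H1|H1|H1|H1] := E (mul a c); try congruence;
have [H2|H2|H2|H2] := E (mul a a); try congruence;
have [H3|H3|H3|H3] := E (mul b a); try congruence;
have [H4|H4|H4|H4] := E (mul b c); try congruence;
have [H5|H5|H5|H5] := E (mul b b); try congruence;
have [H6|H6|H6|H6] := E (mul c a); try congruence;
have [H7|H7|H7|H7] := E (mul c b); try congruence;
have [H8|H8|H8|H8] := E (mul c c); try congruence.
all: split=> [x y z|x y]; have [->|->|->|->] := E x;
  have [->|->|->|->] := E y; try (have [->|->|->|->] := E z);
  by rewrite ?(mul1, mulr1, H, H1, H2, H3, H4, H5, H6, H7, H8).
Qed.

Lemma loop_card2_abelian (Q : Type) (mul : Q -> Q -> Q) (e a : Q) :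
  is_quasigroup mul -> left_id e mul -> right_id e mul ->
  a <> e -> (forall x, x = e \/ x = a) ->
  associative mul /\ commutative mul.
Proof.
move=> qg mul1 mulr1 ae E.
have aa : mul a a = e.
  have [//|H] := E (mul a a); case: ae; apply: (quasigroup_injl qg (a := a)).
  by rewrite H mulr1.
split=> [x y z|x y]; have [->|->] := E x; have [->|->] := E y;
  try (have [->|->] := E z); by rewrite ?(mul1, mulr1, aa).
Qed.

Lemma loop_card3_abelian (Q : Type) (mul : Q -> Q -> Q) (e a b : Q) :
  is_quasigroup mul -> left_id e mul -> right_id e mul ->
  a <> e -> b <> e -> a <> b -> (forall x, [\/ x = e, x = a | x = b]) ->
  associative mul /\ commutative mul.
Proof.
move=> qg mul1 mulr1 ae be ab E.
have injl x := @quasigroup_injl _ mul x qg.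
have injr x := @quasigroup_injr _ mul x qg.
have mulNl x y : y <> e -> mul x y <> x.
  by move=> ye H; apply: ye; apply: (injl x); rewrite H mulr1.
have mulNr x y : x <> e -> mul x y <> y.
  by move=> xe H; apply: xe; apply: (injr y); rewrite H mul1.
have abE : mul a b = e.
  by have [//|/(mulNl _ _ be)//|/(mulNr _ _ ae)//] := E (mul a b).
have baE : mul b a = e.
  by have [//|/(mulNr _ _ be)//|/(mulNl _ _ ae)//] := E (mul b a).
have aaE : mul a a = b.
  by have [|/(mulNr _ _ ae)//|//] := E (mul a a); rewrite -abE => /injl.
have bbE : mul b b = a.
  by have [|//|/(mulNr _ _ be)//] := E (mul b b); rewrite -baE => /injl /esym.
split=> [x y z|x y]; have [->|->|->] := E x; have [->|->|->] := E y;
  try (have [->|->|->] := E z); by rewrite ?(mul1, mulr1, abE, baE, aaE, bbE).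
Qed.

Lemma loop_card_le4_abelian (Q : finType) (mul : Q -> Q -> Q) (e : Q) :
  is_quasigroup mul -> left_id e mul -> right_id e mul -> 1 < #|Q| <= 4 ->
  associative mul /\ commutative mul.
Proof.
move=> qg mul1 mulr1.
have eQ := perm_to_rem (mem_enum Q e).
have: uniq (e :: rem e (enum Q)) by rewrite -(perm_uniq eQ) enum_uniq.
have inQ x : x \in e :: rem e (enum Q) by rewrite -(perm_mem eQ) mem_enum.
rewrite cardE (perm_size eQ); move: inQ.
case: (rem e _) => [|a [|b [|c [|? ?]]]] //= inQ.
- rewrite inE andbT eq_sym => /eqP ae _.
  apply: (loop_card2_abelian qg mul1 mulr1 ae) => x.
  by move: (inQ x); rewrite !inE => /orP[]/eqP; tauto.
- rewrite !inE !negb_or ![e == _]eq_sym -!andbA.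
  case/and4P=> /eqP ae /eqP be /eqP ab _ _.
  apply: (loop_card3_abelian qg mul1 mulr1 ae be ab) => x.
  by move: (inQ x); rewrite !inE => /or3P[]/eqP->; constructor.
rewrite !inE !negb_or ![e == _]eq_sym -!andbA.
case/and5P=> /eqP ae /eqP be /eqP ce /eqP ab /and3P[/eqP ac /eqP bc _] _.
apply: (loop_card4_abelian qg mul1 mulr1 ae be ce ab ac bc) => x.
by move: (inQ x); rewrite !inE => /or4P[]/eqP->; constructor.
Qed.

Lemma small_loop_not_full (Q : finType) (mul : Q -> Q -> Q) :
  is_loop mul -> 1 < #|Q| <= 4 -> ~ forall q, full_product mul q.
Proof.
move=> [qg [e [mul1 mulr1]]] cQ full.
have [mulA mulC] := loop_card_le4_abelian qg mul1 mulr1 cQ.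
have: #|Q| <= 1.
  apply/fintype_le1P => p q.
  exact: (full_product_unique mulA mulC mul1).
lia.
Qed.

(** * A loop of order 5 *)

(* The prolongations below need a group of order at least 5: those of Z_4 miss
   one element.  This table was found by exhaustive search. *)
Lemma full_loop5 : exists (Q : finType) (mul : Q -> Q -> Q),
  [/\ is_loop mul, #|Q| = 5 & forall q, full_product mul q].
Proof.
pose tbl := [:: [:: 0; 1; 2; 3; 4]; [:: 1; 0; 3; 4; 2]; [:: 2; 3; 4; 0; 1];
               [:: 3; 4; 1; 2; 0]; [:: 4; 2; 0; 1; 3]].
pose o k : 'I_5 := Ordinal (ltn_pmod k (isT : 0 < 5)).
pose mul (a b : 'I_5) := o (nth 0 (nth [::] tbl a) b).
pose I5 := [:: o 0; o 1; o 2; o 3; o 4].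
(* Statements over ['I_5] become boolean tests on a list, decided by computation. *)
have allI5 (P : pred 'I_5) : all P I5 -> forall x, P x.
  move=> /allP PI5 x; apply: PI5; rewrite !inE -!val_eqE /=.
  by case: x => [[|[|[|[|[|x]]]]] ?].
exists 'I_5, mul; split; first 1 last.
- by rewrite card_ord.
- pose F k := Factor (o k).
  have fullP w : all (fun x => count_mem x (factors w) == 1) I5 ->
      full_product mul (value mul w).
    by move=> /allI5 cw; exists w; split=> // x; apply/eqP.
  (* The word at index [q] multiplies the four nonneutral elements to [q]; the neutral element is
     appended in [w]. *)
  pose W := [:: Product (F 4) (Product (F 3) (Product (F 2) (F 1)));
                Product (Product (F 4) (Product (F 3) (F 1))) (F 2);
                Product (Product (Product (F 2) (F 4)) (F 3)) (F 1);
                Product (Product (Product (F 3) (F 4)) (F 2)) (F 1);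
                Product (Product (Product (F 4) (F 3)) (F 2)) (F 1)].
  pose w (q : 'I_5) := Product (nth (F 0) W q) (F 0).
  have wE q : value mul (w q) = q by apply/eqP; move: q; apply: allI5.
  move=> q; rewrite -(wE q); apply: fullP; move: q; exact: allI5.
split; last first.
  by exists (o 0); split=> x; apply/eqP; move: x; apply: allI5.
apply: inj_is_quasigroup => a x y /eqP E; apply/eqP; move: E; apply/implyP.
- move: y; apply: (allI5); move: x; apply: (allI5); move: a; exact: allI5.
- move: y; apply: (allI5); move: x; apply: (allI5); move: a; exact: allI5.
Qed.

(** * Prolongation of an abelian group *)

Section Prolongation.

Local Open Scope ring_scope.

Variables (G : finZmodType) (th thi : G -> G) (s : G).

(* The Cayley table of [G] with the cells [(x, th x)], [x != 0], replaced by the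
   new element [None]; their former contents [x + th x] go to the new row and
   column, and the missing symbol [s] goes to the corner.  Omitting [x = 0]
   keeps [Some 0] neutral. *)
Definition prolongation (a b : option G) : option G :=
  match a, b with
  | Some x, Some y => if (x != 0) && (y == th x) then None else Some (x + y)
  | Some x, None => if x == 0 then None else Some (x + th x)
  | None, Some y => if y == 0 then None else Some (thi y + y)
  | None, None => Some s
  end.

(** Giving the omitted argument [0] the value [s] packs two conditions into one injectivity: the
    sums [x + th x] with [x != 0] are distinct, and none of them is [s]. *)
Definition orthomorphism_sum (x : G) : G := if x == 0 then s else x + th x.

Hypotheses (thK : cancel th thi) (th0 : th 0 = 0).
Hypothesis sum_inj : injective orthomorphism_sum.

Local Notation mul := prolongation.
Local Notation sigma := orthomorphism_sum.
Local Notation T := (\sum_(x : G) x).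

Let thi0 : thi 0 = 0. Proof. by rewrite -{1}th0 thK. Qed.
Let th_inj : injective th. Proof. exact: can_inj thK. Qed.
Let thiK : cancel thi th. Proof. by apply: (canF_sym thK). Qed.

Let th_eq0 x : (th x == 0) = (x == 0).
Proof. by rewrite -{1}th0 (inj_eq th_inj). Qed.

Let thi_eq0 x : (thi x == 0) = (x == 0).
Proof. by rewrite -{1}thi0 (inj_eq (can_inj thiK)). Qed.

Let sigmaE x : x != 0 -> sigma x = x + th x.
Proof. by rewrite /sigma => /negbTE->. Qed.

Let sigma_neq x : x != 0 -> x + th x != s.
Proof.
move=> x0; rewrite -sigmaE //.
have -> : s = sigma 0 by rewrite /sigma eqxx.
by rewrite (inj_eq sum_inj).
Qed.

Lemma prolongation_loop : is_loop mul.
Proof.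
split; last first.
  exists (Some 0); split=> -[x|] /=; rewrite ?eqxx ?add0r ?addr0 //=.
  by case: ifP => // /andP[/negbTE x0]; rewrite eq_sym th_eq0 x0.
apply: inj_is_quasigroup.
- case=> [a|] [x|] [y|] //=.
  + case: ifP => [/andP[_ /eqP->]|_]; case: ifP => [/andP[_ /eqP->]|_] //.
    by move=> [/addrI->].
  + case: ifP => [/andP[/negbTE-> _]|] //; case: eqP => //= _ xa [/addrI xE].
    by rewrite xE eqxx in xa.
  + case: (altP (a =P 0)) => //= a0; case: ifP => //= xa [/addrI xE].
    by rewrite -xE eqxx in xa.
  + case: (altP (x =P 0)) => [->|x0]; case: (altP (y =P 0)) => [->|y0] // [E].
    rewrite -[x]thiK -[y]thiK; congr (Some (th _)); apply: sum_inj.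
    by rewrite !sigmaE ?thi_eq0 // !thiK.
  + case: ifP => // /negbT x0 [E]; have := @sigma_neq (thi x).
    by rewrite thi_eq0 thiK E eqxx => /(_ x0).
  + case: ifP => // /negbT y0 [E]; have := @sigma_neq (thi y).
    by rewrite thi_eq0 thiK E eqxx => /(_ y0).
- case=> [a|] [x|] [y|] //=.
  + case: ifP => [/andP[_ /eqP->]|_]; case: ifP => [/andP[_ /eqP E]|_] //.
      by move/th_inj: E => ->.
    by move=> [/addIr->].
  + case: (altP (a =P 0)) => [->|a0].
      by rewrite (eq_sym 0 (th x)) th_eq0; case: eqP.
    case: ifP => //= /negbT N [/addIr E]; move: N.
    by rewrite E thi_eq0 a0 thiK eqxx.
  + case: (altP (a =P 0)) => [->|a0].
      by rewrite (eq_sym 0 (th y)) th_eq0; case: eqP.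
    case: ifP => //= /negbT N [/addIr E]; move: N.
    by rewrite -E thi_eq0 a0 thiK eqxx.
  + case: (altP (x =P 0)) => [->|x0]; case: (altP (y =P 0)) => [->|y0] // [E].
    by congr Some; apply: sum_inj; rewrite !sigmaE.
  + by case: ifP => // /negbT x0 [/eqP]; rewrite (negbTE (sigma_neq x0)).
  + by case: ifP => // /negbT x0 [/esym/eqP]; rewrite (negbTE (sigma_neq x0)).
Qed.

(** Since [th] and [sigma] permute [G], summing [sigma] over [G] gives [T = s + (T + T)]. Negation
    permutes [G] as well, so [T = - T] and the double sum vanishes. *)
Let s_sum : s = T.
Proof.
have T_opp : - T = T.
  by rewrite -sumrN [RHS](reindex_inj (@oppr_inj G)).
have TT : T + T = \sum_(x : G | x != 0) sigma x.
  rewrite {2}(reindex_inj th_inj) -big_split (bigD1 0) //= th0 !add0r.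
  by apply: eq_bigr => x x0; rewrite sigmaE.
have: T = s + (T + T).
  by rewrite TT (reindex_inj sum_inj) (bigD1 0) //= {1}/sigma eqxx.
by rewrite -{2}T_opp addNr addr0.
Qed.

(** * Products avoiding the modified cells *)

(* Neither [Some p * Some y] nor [Some y * Some p] is [Some (p + y)]. *)
Definition blocked (p y : G) := [&& p != 0, y == th p & p == th y].

Let product_step L (p y : G) : ~~ blocked p y ->
  product_of mul L (Some p) -> product_of mul (rcons L (Some y)) (Some (p + y)).
Proof.
move=> Nb Lp.
case: (boolP (mul (Some p) (Some y) == Some (p + y))) => [/eqP<-|].
  exact: product_of_rcons.
rewrite /=; case: ifP => [/andP[p0 yE] _|]; last by rewrite eqxx.
have : mul (Some y) (Some p) = Some (p + y).
  rewrite /=; case: ifP => [/andP[y0 pE]|_]; last by rewrite addrC.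
  by rewrite /blocked p0 yE pE in Nb.
move<-; apply: product_of_perm (product_of_mul (product_of_factor mul _) Lp).
by rewrite -perm_rcons.
Qed.

(* If adjoining [y, z] to [p] is blocked in both orders, then injectivity of
   [th] and of the sums [x + th x] forces [y = z]. *)
Let product_two L (p y z : G) : y != 0 -> z != 0 -> y != z ->
  product_of mul L (Some p) ->
  product_of mul (L ++ [:: Some y; Some z]) (Some (p + (y + z))).
Proof.
move=> y0 z0 yz Lp.
have [/andP[Nb1 Nb2]|Nyz] := boolP (~~ blocked p y && ~~ blocked (p + y) z).
  by rewrite addrA -cat_rcons cats1; do 2!apply: product_step => //.
have [/andP[Nb1 Nb2]|Nzy] := boolP (~~ blocked p z && ~~ blocked (p + z) y).
  apply: (@product_of_perm _ _ (L ++ [:: Some z; Some y])).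
    by rewrite perm_cat2l; apply/permPl; exact: (perm_catC [:: Some z]).
  by rewrite (addrC y) addrA -cat_rcons cats1; do 2!apply: product_step => //.
(* The four ways to be blocked in both orders give in turn [y = z], [z = 0], [y = 0] and
   [y + th y = z + th z]. *)
case/nandP: Nyz => /negPn /and3P[p0 /eqP yE /eqP pE];
  case/nandP: Nzy => /negPn /and3P[q0 /eqP zE /eqP qE].
- by rewrite yE zE eqxx in yz.
- by move/eqP: qE; rewrite -pE -subr_eq0 addrAC addrN add0r (negbTE z0).
- by move/eqP: pE; rewrite -qE -subr_eq0 addrAC addrN add0r (negbTE y0).
- case/eqP: yz; apply: sum_inj; rewrite !sigmaE //.
  by rewrite -qE -pE addrCA (addrC z) addrA.
Qed.

(* A single remaining factor may be blocked, except when the total is [s], which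
   is not of the form [p + th p]. *)
Lemma product_extend (S : seq G) L (p : G) :
  uniq S -> 0 \notin S -> (size S == 1%N -> p + \sum_(x <- S) x = s) ->
  product_of mul L (Some p) ->
  product_of mul (L ++ map Some S) (Some (p + \sum_(x <- S) x)).
Proof.
have [k] := ubnP (size S); elim: k => // k IHk in S L p *.
case: S => [|a [|b [|c S]]].
- by rewrite big_nil addr0 cats0.
- rewrite big_seq1 inE cats1 /= => _ _ a0 /(_ isT) E; apply: product_step.
  apply/negP => /and3P[p0 /eqP aE _].
  by move/eqP: E; rewrite aE (negbTE (sigma_neq p0)).
- rewrite /= !inE !negb_or !andbT => _ ab /andP[a0 b0] _ Lp.
  by rewrite big_cons big_seq1; apply: product_two => //; rewrite eq_sym.
move=> /ltnSE ltSk uS S0 _ Lp.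
(* With three or more factors left, one of the first two differs from [th p] and can be adjoined. At
   least two remain afterwards, so the condition on a single factor stays vacuous. *)
have [y yS yp] : exists2 y, y \in [:: a, b, c & S] & y != th p.
  have [aE|] := eqVneq a (th p); last by exists a; rewrite ?mem_head.
  exists b; first by rewrite !inE eqxx orbT.
  move: uS; rewrite cons_uniq in_cons negb_or => /andP[/andP[ab _] _].
  by rewrite -aE eq_sym.
have pS := perm_to_rem yS.
rewrite (perm_big _ pS) big_cons addrA.
apply: (@product_of_perm _ _ (rcons L (Some y) ++
  map Some (rem y [:: a, b, c & S]))).
  rewrite cat_rcons perm_cat2l perm_sym; exact: perm_map pS.
apply: IHk.
- by rewrite size_rem.
- exact: rem_uniq.
- by apply: contra S0; apply: mem_rem.
- by rewrite size_rem.
by apply: product_step => //; rewrite /blocked (negbTE yp) andbF.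
Qed.

(** The neutral factor [Some 0] can be multiplied in last, so only [None] and the nonzero elements
    of [G] matter. *)
Let full_of_product (R : seq G) q : perm_eq (0 :: R) (enum G) ->
  product_of mul (None :: map Some R) q -> full_product mul q.
Proof.
move=> R_G Rq; have -> : q = mul q (Some 0).
  case: q {Rq} => [x|] /=; last by rewrite eqxx.
  case: ifP => [/andP[/negbTE x0]|]; last by rewrite addr0.
  by rewrite eq_sym th_eq0 x0.
apply: product_of_enum (product_of_rcons _ Rq).
have SomeI : injective (@Some G) by move=> ? ? [].
have /andP[R0 uR] : (0 \notin R) && uniq R.
  by rewrite -cons_uniq (perm_uniq R_G) enum_uniq.
apply: uniq_perm; rewrite ?enum_uniq //.
  rewrite rcons_uniq inE /= (mem_map SomeI) R0 (map_inj_uniq SomeI) uR andbT.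
  by apply/mapP => -[].
case=> [x|]; rewrite mem_enum mem_rcons !inE ?orbT //= (mem_map SomeI).
by have := perm_mem R_G x; rewrite inE mem_enum.
Qed.

Let rest (A : seq G) := [seq x <- enum G | x \notin 0 :: A].

Let rest_perm A : uniq (0 :: A) -> perm_eq (0 :: A ++ rest A) (enum G).
Proof.
move=> uA; rewrite -cat_cons; apply: uniq_perm; rewrite ?enum_uniq //.
  rewrite cat_uniq uA filter_uniq ?enum_uniq // andbT.
  by apply/hasPn => x; rewrite mem_filter => /andP[].
by move=> x; rewrite mem_cat mem_filter mem_enum andbT orbN.
Qed.

Let rest_uniq A : uniq (rest A).
Proof. by rewrite filter_uniq ?enum_uniq. Qed.

Let rest0 A : 0 \notin rest A.
Proof. by rewrite mem_filter inE eqxx. Qed.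

Let rest_size A : uniq (0 :: A) -> (size A + size (rest A)).+1 = #|G|.
Proof. by move/rest_perm/perm_size; rewrite cardE /= size_cat. Qed.

Let rest_sum A : uniq (0 :: A) ->
  \sum_(x <- A) x + \sum_(x <- rest A) x = s.
Proof.
move=> uA; rewrite s_sum -big_enum -(perm_big _ (rest_perm uA)) /=.
by rewrite big_cons big_cat add0r.
Qed.

(** * Reaching every element of the prolongation *)

Hypothesis G_ge5 : (4 < #|G|)%N.

Let mul_None_th z : z != 0 ->
  product_of mul [:: None; Some (th z)] (Some (z + th z)).
Proof.
move=> z0; exists (Product (Factor None) (Factor (Some (th z)))) => //=.
by rewrite th_eq0 (negbTE z0) thK.
Qed.

Let mul_th_None L u : u != 0 -> product_of mul L (Some u) ->
  product_of mul (rcons L (Some (th u))) None.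
Proof.
by move=> u0 /(product_of_rcons (Some (th u))); rewrite /= u0 eqxx.
Qed.

Lemma full_product_shift z : z != 0 -> full_product mul (Some (s + z)).
Proof.
move=> z0; pose A := [:: th z].
have uA : uniq (0 :: A) by rewrite /= inE eq_sym th_eq0 z0.
apply: full_of_product (rest_perm uA) _.
(* The pair [None], [th z] contributes [z + th z] in place of [th z], which shifts the total [s] by
   [z]. *)
have -> : s + z = z + th z + \sum_(x <- rest A) x.
  by rewrite -(rest_sum uA) big_seq1 addrC addrA.
apply: product_extend (rest_uniq A) (rest0 A) _ (mul_None_th z0).
(* As [G] has at least five elements, [rest A] has at least three. *)
by move/eqP=> E; move: G_ge5; rewrite -(rest_size uA) E.
Qed.

(* With [u + th u = s + z], all the factors but [th u] multiply to [u]. *)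
Lemma full_product_None : full_product mul None.
Proof.
(* Excluding [thi s] ensures [u != z] below: [u = z] would force [th z = s]. *)
have /card_gt0P[z] : (0 < #|~: [set 0%R; thi s]|)%N.
  move: G_ge5; rewrite -(cardsC [set 0; thi s]) cards2.
  by case: (_ != _); case: #|_|.
rewrite !inE negb_or => /andP[z0 zs].
(* An injective [sigma] on the finite [G] is onto; [u] is nonzero because [sigma 0 = s] differs from
   [s + z]. *)
pose u := invF sum_inj (s + z).
have uE : sigma u = s + z by apply: f_invF.
have u0 : u != 0.
  apply: contra z0 => /eqP u0; move: uE; rewrite u0 /sigma eqxx => /eqP.
  by rewrite -subr_eq0 opprD addrA addrN sub0r oppr_eq0.
rewrite sigmaE // in uE.
pose A := [:: th z; th u].
have uz : u != z.
  apply: contra zs => /eqP uz; move: uE; rewrite uz addrC => /addIr <-.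
  by rewrite thK.
have uA : uniq (0 :: A).
  rewrite /= !inE !(eq_sym 0) !th_eq0 (inj_eq th_inj) (eq_sym z u).
  by rewrite uz negb_or z0 u0.
apply: (@full_of_product (th z :: rcons (rest A) (th u))).
  apply: perm_trans (rest_perm uA); rewrite perm_cons /= perm_cons.
  by rewrite perm_rcons.
rewrite /= map_rcons -!rcons_cons; apply: mul_th_None => //.
have -> : u = z + th z + \sum_(x <- rest A) x.
  apply: (addIr (th u)); rewrite uE -(rest_sum uA) big_cons big_seq1.
  by rewrite [LHS]addrC !addrA addrAC.
apply: (product_extend (rest_uniq A) (rest0 A) _ (mul_None_th z0)).
by move/eqP=> E; move: G_ge5; rewrite -(rest_size uA) E.
Qed.

(* [((None * th z) * th u) * th v] is [v + th v], as the inner product is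
   [u * th u = None]. *)
Lemma full_product_sum z : let u := z + th z in
  [/\ z != 0, u != 0, th z + th u != 0, th u != z & th z + th u != z] ->
  full_product mul (Some s).
Proof.
move=> u [z0 u0 v0 uz vz]; set v := th z + th u in v0 vz *.
pose A := [:: th z; th u; th v].
have uA : uniq (0 :: A).
  have zu : z != u by rewrite -subr_eq0 opprD addrA addrN sub0r oppr_eq0 th_eq0.
  have uv : u != v.
    by rewrite /u /v addrC (inj_eq (addrI _)) eq_sym.
  rewrite /= !inE !(eq_sym 0) !th_eq0 !(inj_eq th_inj) !negb_or.
  by rewrite z0 u0 v0 zu uv eq_sym vz.
have sE : s = v + th v + \sum_(x <- rest A) x.
  by rewrite -(rest_sum uA) !big_cons big_nil addr0 !addrA.
apply: full_of_product (rest_perm uA) _; rewrite sE.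
(* When [G] has order 5, [rest A] is a single factor; this is allowed because the total is [s]. *)
apply: (product_extend (L := [:: None; Some (th z); Some (th u); Some (th v)])
  (rest_uniq A) (rest0 A)) => //.
have uN := mul_th_None u0 (mul_None_th z0).
by have /= := product_of_rcons (Some (th v)) uN; rewrite th_eq0 (negbTE v0) thK.
Qed.

Lemma prolongation_full z : let u := z + th z in
  [/\ z != 0, u != 0, th z + th u != 0, th u != z & th z + th u != z] ->
  forall q, full_product mul q.
Proof.
move=> u /full_product_sum sum_full [x|]; last exact: full_product_None.
have [->//|xs] := eqVneq x s.
have -> : x = s + (x - s) by rewrite addrC subrK.
by apply: full_product_shift; rewrite subr_eq0.
Qed.
End Prolongation.

(** * Suitable permutations of cyclic groups *)

Lemma full_loop_of_orthomorphism (G : finZmodType) (th : G -> G) (s z : G) :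
  injective th -> th 0%R = 0%R -> injective (orthomorphism_sum th s) ->
  4 < #|G| -> let u := (z + th z)%R in
  [/\ z != 0, u != 0, th z + th u != 0, th u != z & th z + th u != z]%R ->
  exists (Q : finType) (mul : Q -> Q -> Q),
    [/\ is_loop mul, #|Q| = #|G|.+1 & forall q, full_product mul q].
Proof.
move=> th_inj th0 sum_inj G5 u uP.
have thK : cancel th (invF th_inj) by apply: invF_f.
exists (option G), (prolongation th (invF th_inj) s); split.
- exact: prolongation_loop.
- exact: card_option.
- exact: prolongation_full thK th0 sum_inj G5 _ uP.
Qed.

(** Replaces the modulus by a case distinction, which [lia] can handle. *)
Lemma val_addI n (x y : 'I_n.+1) :
  (x + y)%R = (if x + y <= n then x + y else x + y - n.+1) :> nat.
Proof.
case: ifP => /= xyn; first by rewrite modn_small.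
rewrite -[in LHS](subnK (m := n.+1) (n := x + y)); last by lia.
rewrite modnDr modn_small //; have := ltn_ord x; have := ltn_ord y; lia.
Qed.

Lemma ord_eqE n (x y : 'I_n) : (x == y) = (x == y :> nat).
Proof. by []. Qed.

(** In Z_(2h+1) the identity serves as [th]: doubling is injective in odd order, and its nonzero
    arguments miss exactly [s = 0]. The choice [z = 1] gives [u = 2] and [th z + th u = 3], which is
    nonzero as the order is at least 5. *)
Lemma full_loop_even h : 1 < h -> exists (Q : finType) (mul : Q -> Q -> Q),
  [/\ is_loop mul, #|Q| = h.*2.+2 & forall q, full_product mul q].
Proof.
move=> h1; have <- : #|'I_h.*2.+1| = h.*2.+1 by rewrite card_ord.
have one_lt : 1 < h.*2.+1 by lia.
apply: (@full_loop_of_orthomorphism _ id 0%R (Ordinal one_lt)) => //.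
- move=> x y; rewrite /orthomorphism_sum !ord_eqE => /(congr1 (@nat_of_ord _)).
  have := ltn_ord x; have := ltn_ord y.
  by do 2!case: ifP; rewrite ?val_addI /=; try (do ?case: ifP);
    move=> *; apply: val_inj => /=; lia.
- by rewrite card_ord; lia.
by split; rewrite ord_eqE ?val_addI /=; do ?case: ifP; lia.
Qed.

(* In Z_(2h), take [th x = x + h - 1] for [0 < x <= h] and [th x = x - h] for
   [x > h]: the sums [x + th x] of the first kind are the residues of the parity
   of [h + 1], and those of the second kind the ones of the parity of [h], other
   than [s = h]. *)
Lemma full_loop_odd h : 2 < h -> exists (Q : finType) (mul : Q -> Q -> Q),
  [/\ is_loop mul, #|Q| = h.*2.+1 & forall q, full_product mul q].
Proof.
move=> h2; have [m mE] : exists m, h.*2 = m.+1 by exists h.*2.-1; lia.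
have <- : #|'I_m.+1| = h.*2 by rewrite card_ord.
have f_lt (x : 'I_m.+1) :
    (if x == 0 :> nat then 0 else if x <= h then x + h - 1 else x - h) < m.+1.
  by have := ltn_ord x; do 2?case: ifP; lia.
(* The witness [z = h + 1] gives [th z = 1], [u = h + 2] and [th u = 2]; then [th z + th u = 3]
   differs from [z] because [h > 2]. *)
have [h_lt z_lt] : h < m.+1 /\ h.+1 < m.+1 by lia.
pose th (x : 'I_m.+1) := Ordinal (f_lt x).
apply: (@full_loop_of_orthomorphism _ th (Ordinal h_lt) (Ordinal z_lt)) => //.
- move=> x y /(congr1 val) /=; have := ltn_ord x; have := ltn_ord y.
  by do 4?case: ifP; move=> *; apply: val_inj => /=; lia.
- exact: val_inj.
- move=> x y; rewrite /orthomorphism_sum !ord_eqE => /(congr1 (@nat_of_ord _)).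
  have := ltn_ord x; have := ltn_ord y.
  by do 2!case: ifP; rewrite ?val_addI /=; try (do ?case: ifP);
    move=> *; apply: val_inj => /=; lia.
- by rewrite card_ord; lia.
have thE x : th x = (if x == 0 :> nat then 0 else
    if x <= h then x + h - 1 else x - h) :> nat by [].
have uE : (Ordinal z_lt + th (Ordinal z_lt))%R = h.+2 :> nat.
  by rewrite val_addI /=; do ?case: ifP; lia.
have thu : th (Ordinal z_lt + th (Ordinal z_lt))%R = 2 :> nat.
  by rewrite thE uE; do ?case: ifP; lia.
have thz : th (Ordinal z_lt) = 1 :> nat by rewrite /=; do ?case: ifP; lia.
by split; rewrite ord_eqE ?val_addI ?thu ?thz ?uE /=; do ?case: ifP; lia.
Qed.

(** * The orders of loops with [P(Q) = Q] *)

Theorem theorem3p2 (n : nat) (n_gt0 : 0 < n) :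
  (exists (Q : finType) (mul : Q -> Q -> Q),
      [/\ is_loop mul, #|Q| = n & forall q : Q, full_product mul q])
  <-> (n = 1 \/ 5 <= n).
Proof.
split=> [[Q [mul [loopQ cardQ fullQ]]] | [-> | n5]].
- have [n1|n5] : n = 1 \/ 5 <= n \/ 1 < n <= 4 by lia.
    by left.
  case: n5 => [|n_small]; first by right.
  by case: (@small_loop_not_full _ mul loopQ); rewrite ?cardQ.
- exists unit, (fun _ _ => tt); split; last 2 first.
  + exact: card_unit.
  + by case; exists (Factor tt); split=> // -[].
  split; last by exists tt; split=> -[].
  by apply: inj_is_quasigroup => a [] [].
have [->|n_neq5] := eqVneq n 5; first exact: full_loop5.
(* From order 6 on, Z_(n-1) is prolonged; its order is even for odd [n] and odd for even [n]. *)
have nE := odd_double_half n; case: (boolP (odd n)) nE => [_|_] nE.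
- by rewrite -nE; apply: full_loop_odd; lia.
have -> : n = n./2.-1.*2.+2 by lia.
by apply: full_loop_even; lia.
Qed.
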